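(* Let $Q\subset\mathbb{R}^d$ be a compact convex polyhedron, and let $f:Q\to\mathbb{R}$ be a continuous convex function with $\|f\|_{\mathrm{Lip}}=L<\infty$. Let $f_n:Q\to\mathbb{R}$ be a function (an estimator of $f$), let $\delta_n>0$, and let $\mathcal{M}_n\subset Q$ be a finite set such that any $x\in Q$ is a convex combination of points of $\mathcal{M}_n$ whose distance to $x$ is not more than $\delta_n$. Let $f^c_n$ be the convex estimator associated with $f_n$ and $\mathcal{M}_n$. Suppose that $$\sup\{|f_n(x)-f(x)| : x\in\mathcal{M}_n\}\le\varepsilon_n .$$ Then $$-\varepsilon_n\le f^c_n(x)-f(x)\le\varepsilon_n+L\delta_n\quad\text{for all }x\in Q.$$
   Context: $|x-y|$ denotes the Euclidean distance in $\mathbb{R}^d$, and $\|f\|_{\mathrm{Lip}}=\sup\{|f(x)-f(y)|/|x-y| : x,y\in Q,\ x\neq y\}$. $Q$ is a (nonempty) bounded closed convex polyhedron, i.e. the convex hull of its finite set of vertices. $\mathscr{C}$ denotes the set of finite real-valued convex functions defined on $Q$. For $f_n:Q\to\mathbb{R}$ and a finite set $\mathcal{M}_n\subset Q$ whose convex hull is $Q$ (which is automatic under the condition on $\mathcal{M}_n$ in the claim), put $$\mathscr{L}_n=\{\psi\in\mathscr{C} : \psi(x)\le f_n(x)\text{ for all }x\in\mathcal{M}_n\}.$$ The convex estimator associated with $f_n$ and $\mathcal{M}_n$ is the pointwise supremum $f^c_n=\sup\{\psi : \psi\in\mathscr{L}_n\}$ on $Q$. Here $n$ is a fixed index; no relation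 between $n$ and the number of points of $\mathcal{M}_n$ is assumed. *)

(* Defs.v *)
From HB Require Import structures.
From mathcomp Require Import all_boot all_order all_algebra.
From mathcomp Require Import all_classical all_reals all_analysis.

Set Implicit Arguments.
Unset Strict Implicit.
Unset Printing Implicit Defensive.

Import Order.TTheory GRing.Theory Num.Theory.
Import numFieldNormedType.Exports.

Local Open Scope classical_set_scope.
Local Open Scope ring_scope.

(* Points of R^d are row vectors.  A function on Q is represented by a total
   function on R^d of which only the values on Q are ever used; since every
   function on Q extends to R^d, suprema over families are unaffected. *)

(* The library norm on 'rV[R]_d is the sup norm, hence this definition. *)
Definition eucl_dist (R : realType) (d : nat) (x y : 'rV[R]_d) : R :=
  Num.sqrt (\sum_(i < d) (x 0 i - y 0 i) ^+ 2).

Definition convex_hull (R : realType) (d : nat) (A : set 'rV[R]_d) :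
    set 'rV[R]_d :=
  [set x | exists (m : nat) (w : 'I_m -> R) (p : 'I_m -> 'rV[R]_d),
     [/\ forall i, 0 <= w i,
         \sum_(i < m) w i = 1,
         forall i, A (p i) &
         x = \sum_(i < m) w i *: p i]].

(* Vertices are meant as extreme points. *)
Definition vertices (R : realType) (d : nat) (Q : set 'rV[R]_d) :
    set 'rV[R]_d :=
  [set x | Q x /\
     forall (y z : 'rV[R]_d) (t : R), Q y -> Q z -> 0 < t -> t < 1 ->
       x = t *: y + (1 - t) *: z -> y = x /\ z = x].

Definition compact_polyhedron (R : realType) (d : nat) (Q : set 'rV[R]_d) :
    Prop :=
  [/\ Q !=set0, finite_set (vertices Q) & Q = convex_hull (vertices Q)].

(* The supremum is taken in [0, +oo], so that it is 0 (and not -oo) when Q is a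
   single point. *)
Definition lip_norm (R : realType) (d : nat) (Q : set 'rV[R]_d)
    (f : 'rV[R]_d -> R) : \bar R :=
  maxe 0%E (ereal_sup [set e | exists x y : 'rV[R]_d,
    [/\ Q x, Q y, x <> y & e = (`|f x - f y| / eucl_dist x y)%:E]]).

Definition convex_minorants (R : realType) (d : nat) (Q M : set 'rV[R]_d)
    (fn : 'rV[R]_d -> R) : set ('rV[R]_d -> R) :=
  [set psi | convex_function Q psi /\ forall x, M x -> psi x <= fn x].

(* The supremum is taken in the extended reals, so that no default value is
   involved should the family be empty or unbounded at x. *)
Definition convex_estimator (R : realType) (d : nat) (Q M : set 'rV[R]_d)
    (fn : 'rV[R]_d -> R) (x : 'rV[R]_d) : \bar R :=
  ereal_sup [set (psi x)%:E | psi in convex_minorants Q M fn].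

(* Main.v *)
Require Import Defs.
From HB Require Import structures.
From mathcomp Require Import all_boot all_order all_algebra.
From mathcomp Require Import all_classical all_reals all_analysis.
From mathcomp Require Import ring lra.

Set Implicit Arguments.
Unset Strict Implicit.
Unset Printing Implicit Defensive.

(** Both bounds come from comparing [f] with the minorants of the data.

    Lower bound: [f - eps] is convex, and it lies below [fn] on [M] because
    [fn] is [eps]-close to [f] there; so it is one of the functions of which the
    estimator is the supremum.

    Upper bound: let [psi] be convex with [psi <= fn] on [M], and write [x] as
    a convex combination of points [p i] of [M] at distance at most [delta]
    from [x].  By Jensen's inequality [psi x] is at most the mean of the
    [psi (p i)], and each of these is at most
    [fn (p i) <= f (p i) + eps <= f x + L * delta + eps].

    Jensen's inequality for finite combinations ([convex_function_sum]) is the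
    statement that the epigraph, a convex set, is stable under finite convex
    combinations ([convex_set_sum]); it needs the domain [Q] to be convex, which
    holds because [Q] is a convex hull ([convex_set_convex_hull]). *)

Import Order.TTheory GRing.Theory Num.Theory.
Import numFieldNormedType.Exports.

Local Open Scope classical_set_scope.
Local Open Scope ring_scope.

Lemma convex_setP (R : realType) (E : lmodType R) (A : set E) :
  convex_set A <->
  forall (x y : E) (t : R), A x -> A y -> 0 <= t -> t <= 1 ->
    A (t *: x + (1 - t) *: y).
Proof.
split=> [cA x y t Ax Ay t0 t1|cA x y t /set_mem Ax /set_mem Ay].
  by apply/set_mem; apply: (cA x y (Itv01 t0 t1)); apply/mem_set.
by apply/mem_set; exact: (cA x y t%:num).
Qed.

Lemma convex_functionP (R : realType) (E : lmodType R) (A : set E)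
    (g : E -> R) :
  convex_function A g <->
  forall (x y : E) (t : R), A x -> A y -> 0 <= t -> t <= 1 ->
    g (t *: x + (1 - t) *: y) <= t * g x + (1 - t) * g y.
Proof.
split=> [cg x y t Ax Ay t0 t1|cg t x y /set_mem Ax /set_mem Ay].
  by apply: (cg (Itv01 t0 t1) x y); apply/mem_set.
exact: (cg x y t%:num).
Qed.

(** Peel off the first point with weight [w 0] and rescale the remaining
    weights by [1 - w 0]. *)
Lemma convex_set_sum (R : realType) (E : lmodType R) (A : set E) (m : nat)
    (w : 'I_m -> R) (p : 'I_m -> E) :
  convex_set A -> (forall i, 0 <= w i) -> \sum_(i < m) w i = 1 ->
  (forall i, A (p i)) -> A (\sum_(i < m) w i *: p i).
Proof.
move=> /convex_setP cA; elim: m w p => [|m IH] w p w0 w1 Ap.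
  by move: w1; rewrite big_ord0 => /esym/eqP; rewrite oner_eq0.
set s := \sum_(i < m) w (lift ord0 i).
have ws : s = 1 - w ord0 by rewrite -w1 big_ord_recl addrAC subrr add0r.
have s0 : 0 <= s by apply: sumr_ge0.
(* Rescaling is impossible when [w 0 = 1]; the sum is then [p 0]. *)
rewrite big_ord_recl; have [sE|sN0] := eqVneq s 0.
  rewrite big1 => [|i _].
    have w01 : w ord0 = 1 by apply/eqP; rewrite eq_sym -subr_eq0 -ws sE.
    by rewrite w01 scale1r addr0.
  suff -> : w (lift ord0 i) = 0 by rewrite scale0r.
  move/eqP: sE; rewrite psumr_eq0// => /allP/(_ i).
  by rewrite mem_index_enum => /(_ isT)/eqP.
have -> : \sum_(i < m) w (lift ord0 i) *: p (lift ord0 i) =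
    (1 - w ord0) *: \sum_(i < m) (w (lift ord0 i) / s) *: p (lift ord0 i).
  rewrite scaler_sumr; apply: eq_bigr => i _.
  by rewrite scalerA -ws mulrC divfK.
apply: cA => //; last by lra.
apply: IH => [i||i] //; first by rewrite divr_ge0.
by rewrite -mulr_suml divff.
Qed.

(** Two combinations of points are mixed by concatenating the families and
    scaling their weights by [t] and [1 - t]. *)
Lemma convex_set_convex_hull (R : realType) (d : nat) (A : set 'rV[R]_d) :
  convex_set (convex_hull A).
Proof.
apply/convex_setP => x y t [m [u [p [u0 u1 Ap ->]]]] [n [v [q [v0 v1 Aq ->]]]].
move=> t0 t1; exists (m + n)%N.
exists (fun i : 'I_(m + n) => match fintype.split i with
  inl j => t * u j | inr k => (1 - t) * v k end).
exists (fun i : 'I_(m + n) => match fintype.split i with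
  inl j => p j | inr k => q k end).
have sl (j : 'I_m) : fintype.split (lshift n j) = inl j := unsplitK (inl j).
have sr (k : 'I_n) : fintype.split (rshift m k) = inr k := unsplitK (inr k).
split.
- by move=> i; case: (fintype.split i) => j; rewrite mulr_ge0// subr_ge0.
- rewrite big_split_ord/=.
  under eq_bigr do rewrite sl; under [X in _ + X]eq_bigr do rewrite sr.
  by rewrite -!mulr_sumr u1 v1; ring.
- by move=> i; case: (fintype.split i).
- rewrite big_split_ord/= !scaler_sumr.
  by congr (_ + _); apply: eq_bigr => i _; rewrite (sl, sr) scalerA.
Qed.

(** Jensen's inequality: the points [(p i, g (p i))] lie in the epigraph of
    [g], so their mean does too. *)
Lemma convex_function_sum (R : realType) (E : lmodType R) (A : set E)
    (g : E -> R) (m : nat) (w : 'I_m -> R) (p : 'I_m -> E) :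
  convex_set A -> convex_function A g ->
  (forall i, 0 <= w i) -> \sum_(i < m) w i = 1 -> (forall i, A (p i)) ->
  g (\sum_(i < m) w i *: p i) <= \sum_(i < m) w i * g (p i).
Proof.
move=> /convex_setP cA /convex_functionP cg w0 w1 Ap.
pose epi := [set z : E * R^o | A z.1 /\ g z.1 <= z.2].
have cepi : convex_set epi.
  apply/convex_setP => -[x a] [y b] t [/= Ax gx] [/= Ay gy] t0 t1.
  split => /=; first exact: cA.
  apply: (le_trans (cg x y t Ax Ay t0 t1)).
  by rewrite lerD// ler_wpM2l// subr_ge0.
have epip i : epi (p i, g (p i)) by split; [exact: Ap|exact: lexx].
have [_] := convex_set_sum cepi w0 w1 epip.
by rewrite !raddf_sum.
Qed.

Lemma eucl_dist_ge0 (R : realType) (d : nat) (x y : 'rV[R]_d) :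
  0 <= eucl_dist x y.
Proof. exact: sqrtr_ge0. Qed.

Lemma eucl_dist_eq0 (R : realType) (d : nat) (x y : 'rV[R]_d) :
  eucl_dist x y = 0 -> x = y.
Proof.
move/eqP; rewrite sqrtr_eq0 => sum_le0.
have /eqP : \sum_(i < d) (x 0 i - y 0 i) ^+ 2 = 0.
  by apply/le_anti; rewrite sum_le0 sumr_ge0// => i _; exact: sqr_ge0.
rewrite psumr_eq0 => [/allP xy0|i _]; last exact: sqr_ge0.
apply/rowP => i; move: (xy0 i); rewrite mem_index_enum => /(_ isT).
by rewrite sqrf_eq0 subr_eq0 => /eqP.
Qed.

Lemma lip_norm_ge0 (R : realType) (d : nat) (Q : set 'rV[R]_d)
    (f : 'rV[R]_d -> R) (L : R) :
  lip_norm Q f = L%:E -> 0 <= L.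
Proof. by move=> fL; rewrite -lee_fin -fL /lip_norm le_max lexx. Qed.

Lemma lip_norm_le (R : realType) (d : nat) (Q : set 'rV[R]_d)
    (f : 'rV[R]_d -> R) (L : R) (x y : 'rV[R]_d) :
  lip_norm Q f = L%:E -> Q x -> Q y -> `|f x - f y| <= L * eucl_dist x y.
Proof.
move=> fL Qx Qy; have [->|/eqP xy] := eqVneq x y.
  by rewrite subrr normr0 mulr_ge0 ?eucl_dist_ge0 ?(lip_norm_ge0 fL).
have d0 : 0 < eucl_dist x y.
  by rewrite lt_neqAle eucl_dist_ge0 andbT eq_sym; apply/eqP => /eucl_dist_eq0.
rewrite -ler_pdivrMr// -lee_fin -fL /lip_norm le_max; apply/orP; right.
by apply: ereal_sup_ubound; exists x, y.
Qed.

Theorem theorem1 (R : realType) (d : nat) (Q : set 'rV[R]_d)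
    (f : 'rV[R]_d -> R) (L : R)
    (fn : 'rV[R]_d -> R) (delta eps : R) (M : set 'rV[R]_d)
    (hQ : compact_polyhedron Q)
    (f_cont : {within Q, continuous f})
    (f_conv : convex_function Q f)
    (f_lip : lip_norm Q f = L%:E)
    (delta_gt0 : 0 < delta)
    (M_fin : finite_set M)
    (MQ : M `<=` Q)
    (M_delta : forall x, Q x ->
       convex_hull [set y | M y /\ eucl_dist y x <= delta] x)
    (fn_eps : (ereal_sup [set (`|fn x - f x|)%:E | x in M] <= eps%:E)%E) :
  forall x, Q x ->
    ((- eps)%:E <= convex_estimator Q M fn x - (f x)%:E)%E /\
    (convex_estimator Q M fn x - (f x)%:E <= (eps + L * delta)%:E)%E.
Proof.
have cQ : convex_set Q by case: hQ => _ _ ->; exact: convex_set_convex_hull.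
have fn_close y : M y -> `|fn y - f y| <= eps.
  move=> My; rewrite -lee_fin; apply: le_trans fn_eps.
  by apply: ereal_sup_ubound; exists y.
move=> x Qx; split.
  rewrite leeBrDr// -EFinD; apply: ereal_sup_ubound.
  exists (fun y => - eps + f y) => //; split.
    move/convex_functionP: f_conv => fc.
    apply/convex_functionP => y z t Qy Qz t0 t1.
    by have := fc y z t Qy Qz t0 t1; lra.
  by move=> y /fn_close; rewrite ler_norml => /andP[]; lra.
rewrite leeBlDr// -EFinD; apply: ge_ereal_sup => _ [psi [psi_conv psi_fn] <-].
rewrite lee_fin; have [m [w [p [w0 w1 pM xE]]]] := M_delta x Qx.
have Qp i : Q (p i) by apply: MQ; case: (pM i).
rewrite {1}xE; apply: (le_trans (convex_function_sum cQ psi_conv w0 w1 Qp)).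
(* As the weights sum to 1, the constant bound is itself a weighted mean, and
   the two means can be compared termwise. *)
rewrite -[leRHS]mul1r -w1 mulr_suml; apply: ler_sum => i _.
apply: ler_wpM2l => //; have [Mp px] := pM i.
have fpx : f (p i) - f x <= L * delta.
  apply: (le_trans (ler_norm _)).
  apply: (le_trans (lip_norm_le f_lip (Qp i) Qx)).
  by rewrite ler_wpM2l// (lip_norm_ge0 f_lip).
have := psi_fn _ Mp; move: (fn_close _ Mp); rewrite ler_norml => /andP[_]; lra.
Qed.
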